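(* Let $G$ be a torsion-free nilpotent group of class $c$, with isolated lower central series $G = \overline{\gamma}_1(G) \ge \overline{\gamma}_2(G) \ge \ldots \ge \overline{\gamma}_{c+1}(G) = 1$. Let $\varphi,\psi \colon G \to G$ be endomorphisms and, for $1 \le i \le c$, let $\varphi_i,\psi_i \colon \overline{\gamma}_i(G)/\overline{\gamma}_{i+1}(G) \to \overline{\gamma}_i(G)/\overline{\gamma}_{i+1}(G)$ denote the induced endomorphisms of the torsion-free abelian factor groups. (1) Suppose that $G$ has finite rank and that $R(\varphi,\psi) < \infty$. Then, for $1 \le i \le c$, the coincidence set \[ \mathrm{Coin}(\varphi_i,\psi_i) = \{ \bar{x} \in \overline{\gamma}_i(G)/\overline{\gamma}_{i+1}(G) \mid \bar{x}\varphi_i = \bar{x}\psi_i \} \] is a singleton, i.e. consists only of the identity element of $\overline{\gamma}_i(G)/\overline{\gamma}_{i+1}(G)$. (2) Suppose that, for $1 \le i \le c$, the coincidence set $\mathrm{Coin}(\varphi_i,\psi_i)$ is a singleton. Then there is a bijection between $\mathcal{R}(\varphi,\psi)$ and $\prod_{i=1}^c \mathcal{R}(\varphi_i,\psi_i)$. In particular, $R(\varphi,\psi) < \infty$ if and only if $R(\varphi_i,\psi_i) < \infty$ for $1 \le i \le c$, and in this case $R(\varphi,\psi) = \prod_{i=1}^c R(\varphi_i,\psi_i)$.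
   Context: Maps are written on the right. For endomorphisms $\varphi,\psi$ of a group $G$, elements $x,y \in G$ are $(\varphi,\psi)$-twisted conjugate if there is $g \in G$ with $x = (g\varphi)^{-1} y (g\psi)$. This is an equivalence relation; $\mathcal{R}(\varphi,\psi)$ is the set of its classes, and $R(\varphi,\psi) = \lvert \mathcal{R}(\varphi,\psi) \rvert$. A group has finite (Prüfer) rank if there is an integer $r$ such that every finitely generated subgroup can be generated by $r$ elements. For a torsion-free nilpotent group $G$ of class $c$ with lower central series $G = \gamma_1(G) \ge \ldots \ge \gamma_{c+1}(G) = 1$, let $\overline{\gamma}_i(G)$, $1 \le i \le c+1$, be the subgroup of $G$ containing $\gamma_i(G)$ such that $\overline{\gamma}_i(G)/\gamma_i(G)$ is the torsion subgroup of $G/\gamma_i(G)$. The resulting series is the isolated lower central series; it is a central series of fully invariant subgroups with torsion-free abelian factors. *)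

(* Defs.v *)
From HB Require Import structures.
From mathcomp Require Import all_boot.
From mathcomp Require Import finmap.
From mathcomp Require Import boolp classical_sets functions cardinality.

Set Implicit Arguments.
Unset Strict Implicit.
Unset Printing Implicit Defensive.

Import Algebra.

Local Open Scope classical_set_scope.
Local Open Scope quotient_scope.
Local Open Scope group_scope.

HB.mixin Record isConjClosed (G : groupType) (S : {pred G}) := {
  conj_closed : {in S, forall x y, x ^ y \in S}
}.

#[short(type="normalClosed")]
HB.structure Definition NormalClosed (G : groupType) :=
  {S of isConjClosed G S & GroupClosed G S}.

Section SubgroupType.
Variables (G : groupType) (H : groupClosed G).

Definition subgroup_of := {x : G | x \in H}.

HB.instance Definition _ := SubChoice.on subgroup_of.

Fact subgroup_of_closed : group_closed (fun x : G => x \in H).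
Proof. by split=> [|x y xH yH]; [exact: gpred1 | exact: gpredF]. Qed.

HB.instance Definition _ :=
  SubChoice_isSubGroup.Build G _ subgroup_of subgroup_of_closed.

End SubgroupType.

Section QuotientGroup.
Variables (G : groupType) (N : normalClosed G).

Definition coset_eq (x y : G) := x^-1 * y \in N.

Fact coset_eq_equiv : equiv_class_of coset_eq.
Proof.
split=> [x|x y|y x z]; rewrite /coset_eq.
- by rewrite mulVg gpred1.
- by rewrite -gpredV invgM invgK.
- by move=> xy yz; rewrite -(mulgK y x^-1) -mulgA gpredM.
Qed.

Canonical coset_equiv := EquivRelPack coset_eq_equiv.

Definition qgroup := {eq_quot coset_equiv}.

HB.instance Definition _ := Choice.on qgroup.
HB.instance Definition _ := EqQuotient.on qgroup.

Definition qclass (x : G) : qgroup := \pi x.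

Definition qmul (X Y : qgroup) : qgroup := qclass (repr X * repr Y).
Definition qinv (X : qgroup) : qgroup := qclass (repr X)^-1.

Lemma qclass_eq x y : (qclass x = qclass y) <-> (x^-1 * y \in N).
Proof. by rewrite /qclass; split=> [/eqmodP|h]; last exact/eqmodP. Qed.

Lemma qclass_repr x : (repr (qclass x))^-1 * x \in N.
Proof. by apply/qclass_eq; rewrite {1}/qclass reprK. Qed.

Fact qclass_mul x y : qclass (x * y) = qmul (qclass x) (qclass y).
Proof.
symmetry; apply/qclass_eq; set x' := repr (qclass x); set y' := repr (qclass y).
have -> : (x' * y')^-1 * (x * y) = (x'^-1 * x) ^ y' * (y'^-1 * y).
  by rewrite /conjg invgM -!mulgA mulVKg.
by rewrite gpredM ?conj_closed ?qclass_repr.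
Qed.

Fact qclass_inv x : qclass x^-1 = qinv (qclass x).
Proof.
apply/qclass_eq; set x' := repr (qclass x).
have -> : x^-1^-1 * x'^-1 = (x'^-1 * x) ^ x'^-1.
  by rewrite /conjg !invgK -mulgA mulVKg.
by rewrite conj_closed ?qclass_repr.
Qed.

Lemma qclass_surj X : exists x, qclass x = X.
Proof. by exists (repr X); rewrite /qclass reprK. Qed.

Fact qmulA : associative qmul.
Proof.
move=> X Y Z; have [x <-] := qclass_surj X; have [y <-] := qclass_surj Y.
by have [z <-] := qclass_surj Z; rewrite -!qclass_mul mulgA.
Qed.
Fact qmul1 : left_id (qclass 1) qmul.
Proof. by move=> X; have [x <-] := qclass_surj X; rewrite -qclass_mul mul1g. Qed.
Fact qmulr1 : right_id (qclass 1) qmul.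
Proof. by move=> X; have [x <-] := qclass_surj X; rewrite -qclass_mul mulg1. Qed.
Fact qmulV : left_inverse (qclass 1) qinv qmul.
Proof.
by move=> X; have [x <-] := qclass_surj X; rewrite -qclass_inv -qclass_mul mulVg.
Qed.
Fact qmulrV : right_inverse (qclass 1) qinv qmul.
Proof.
by move=> X; have [x <-] := qclass_surj X; rewrite -qclass_inv -qclass_mul mulgV.
Qed.

HB.instance Definition _ := isGroup.Build qgroup qmulA qmul1 qmulr1 qmulV qmulrV.

HB.instance Definition _ :=
  isMultiplicative.Build G qgroup qclass qclass_mul.
HB.instance Definition _ :=
  Multiplicative_isUMagmaMorphism.Build G qgroup qclass erefl.

Lemma qclass_eq1 x : (qclass x = 1) <-> (x \in N).
Proof.
by rewrite -gpredV -[x^-1]mulg1; apply: (iff_trans _ (qclass_eq x 1)).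
Qed.

End QuotientGroup.

Section GroupMorphism.
Variables (G H : groupType) (f : {multiplicative G -> H}).

Lemma morph1 : f 1 = 1.
Proof. by apply: (mulgI (f 1)); rewrite -gmulfM !mulg1. Qed.

Lemma morphV : {morph f : x / x^-1}.
Proof. by move=> x; apply: (mulgI (f x)); rewrite -gmulfM !mulgV morph1. Qed.

Lemma morphX n : {morph f : x / x ^+ n}.
Proof.
by elim: n => [|n IHn] x; rewrite ?expg0 ?morph1// !expgS gmulfM IHn.
Qed.

Lemma morphJ : {morph f : x y / x ^ y}.
Proof. by move=> x y; rewrite /conjg !gmulfM morphV. Qed.

Lemma morphR : {morph f : x y / [~ x, y]}.
Proof. by move=> x y; rewrite /commg gmulfM morphV morphJ. Qed.

End GroupMorphism.

Definition generated (G : groupType) (A : {pred G}) : {pred G} :=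
  [pred x | `[< forall S : groupClosed G, {subset A <= S} -> x \in S >]].

Section Generated.
Variable G : groupType.
Implicit Types A : {pred G}.

Lemma mem_generated A : {subset A <= generated A}.
Proof. by move=> x Ax; apply/asboolP => S; apply. Qed.

Fact generatedM A : mulg_closed (generated A).
Proof.
move=> x y /asboolP xA /asboolP yA; apply/asboolP => S AS.
by rewrite gpredM ?xA ?yA.
Qed.
Fact generated1 A : 1 \in generated A.
Proof. by apply/asboolP => S _; exact: gpred1. Qed.
Fact generatedV A : invg_closed (generated A).
Proof. by move=> x /asboolP xA; apply/asboolP => S AS; rewrite gpredV xA. Qed.

HB.instance Definition _ A := isMulClosed.Build G (generated A) (@generatedM A).
HB.instance Definition _ A := isMul1Closed.Build G (generated A) (generated1 A).
HB.instance Definition _ A := isInvClosed.Build G (generated A) (@generatedV A).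

Lemma generated_ind A (P : G -> Prop) :
  P 1 -> (forall x y, P x -> P y -> P (x * y)) -> (forall x, P x -> P x^-1) ->
  {in A, forall x, P x} -> {in generated A, forall x, P x}.
Proof.
move=> P1 PM PV PA x /asboolP xA.
pose S : {pred G} := [pred y | `[< P y >]].
have SM : mulg_closed S.
  by move=> u v /asboolP Pu /asboolP Pv; apply/asboolP/PM.
have S1 : 1 \in S by exact/asboolP.
have SV : invg_closed S by move=> u /asboolP Pu; apply/asboolP/PV.
pose S' : groupClosed G := HB.pack S (isMulClosed.Build G S SM)
  (isMul1Closed.Build G S S1) (isInvClosed.Build G S SV).
by apply/asboolP/(xA S') => y /PA Py; apply/asboolP.
Qed.

End Generated.

Definition finite_rank (G : groupType) : Prop :=
  exists r : nat, forall s : seq G,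
    exists2 t : seq G, (size t <= r)%N & generated (mem t) =i generated (mem s).

Definition torsion (G : groupType) : {pred G} :=
  [pred x | `[< exists2 n, (0 < n)%N & x ^+ n = 1 >]].
Arguments torsion G : clear implicits.

Definition torsion_free (G : groupType) : Prop :=
  forall x : G, x \in torsion G -> x = 1.

Section LowerCentralSeries.
Variable G : groupType.

Definition commutators (A B : {pred G}) : {pred G} :=
  [pred z | `[< exists x y, [/\ x \in A, y \in B & z = [~ x, y]] >]].

Fixpoint lcs_rec (n : nat) : {pred G} :=
  if n is m.+1 then generated (commutators (lcs_rec m) predT) else predT.

(* Indices start at 0: [lcs n] is the subgroup usually written gamma_(n+1). *)
Definition lcs (n : nat) : {pred G} := lcs_rec n.

Fact lcsM n : mulg_closed (lcs n).
Proof. by case: n => [|n] // x y; exact: gpredM. Qed.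
Fact lcs1 n : 1 \in lcs n.
Proof. by case: n => [|n] //; exact: gpred1. Qed.
Fact lcsV n : invg_closed (lcs n).
Proof. by case: n => [|n] // x; exact: gpredVr. Qed.

HB.instance Definition _ n := isMulClosed.Build G (lcs n) (@lcsM n).
HB.instance Definition _ n := isMul1Closed.Build G (lcs n) (lcs1 n).
HB.instance Definition _ n := isInvClosed.Build G (lcs n) (@lcsV n).

Lemma lcsR n x y : x \in lcs n -> [~ x, y] \in lcs n.+1.
Proof. by move=> xn; apply/mem_generated/asboolP; exists x, y. Qed.

Fact lcsJ n : {in lcs n, forall x y, x ^ y \in lcs n}.
Proof.
elim: n => [|n IHn] // x xn y; move: x xn.
apply: (@generated_ind _ _ (fun x => x ^ y \in lcs n.+1)).
- by rewrite conj1g gpred1.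
- by move=> u v uS vS; rewrite conjMg gpredM.
- by move=> u uS; rewrite conjVg gpredV.
- by move=> _ /asboolP[u [v [un _ ->]]]; rewrite conjRg lcsR ?IHn.
Qed.

HB.instance Definition _ n := isConjClosed.Build G (lcs n) (@lcsJ n).

Lemma lcs_sub n : {subset lcs n.+1 <= lcs n}.
Proof.
apply: (@generated_ind _ _ (fun x => x \in lcs n)).
- exact: gpred1.
- by move=> x y; exact: gpredM.
- by move=> x; rewrite gpredV.
- by move=> _ /asboolP[x [y [xn _ ->]]]; rewrite gpredM ?gpredV ?lcsJ.
Qed.

Lemma lcs_le m n : (m <= n)%N -> {subset lcs n <= lcs m}.
Proof.
move=> /subnK <-; elim: (n - m)%N => [|k IHk] x //; rewrite addSn.
by move=> /lcs_sub/IHk.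
Qed.

End LowerCentralSeries.
Arguments lcs G n : clear implicits, simpl never.

Definition nilpotent_of_class (G : groupType) (c : nat) : Prop :=
  lcs G c =i pred1 1 /\ forall k, (k < c)%N -> ~ (lcs G k =i pred1 1).

(* [ilcs n] is the preimage in [G] of the torsion elements of [G / lcs n]; as *)
(* for [lcs], indices start at 0.                                             *)
Definition ilcs (G : groupType) (n : nat) : {pred G} :=
  [pred x | qclass (lcs G n) x \in torsion (qgroup (lcs G n))].
Arguments ilcs G n : clear implicits.

Section IsolatedLowerCentralSeries.
Variable G : groupType.

Lemma ilcsP n (x : G) :
  x \in ilcs G n <-> exists2 k, (0 < k)%N & x ^+ k \in lcs G n.
Proof.
split=> [/asboolP[k k0 /eqP]|[k k0 xk]].
  by rewrite -(morphX (qclass (lcs G n))) => /eqP/qclass_eq1; exists k.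
apply/asboolP; exists k => //.
by rewrite -(morphX (qclass (lcs G n))); apply/qclass_eq1.
Qed.

Lemma lcs_endo (f : {multiplicative G -> G}) n x :
  x \in lcs G n -> f x \in lcs G n.
Proof.
elim: n x => [|n IHn] //.
apply: (@generated_ind _ _ (fun x => f x \in lcs G n.+1)).
- by rewrite morph1 gpred1.
- by move=> x y; rewrite gmulfM => ? ?; rewrite gpredM.
- by move=> x; rewrite morphV gpredV.
- by move=> _ /asboolP[x [y [xn _ ->]]]; rewrite morphR lcsR ?IHn.
Qed.

Lemma commute_qclass (N : normalClosed G) x y :
  commute (qclass N x) (qclass N y) <-> [~ x, y] \in N.
Proof.
rewrite -qclass_eq1 (morphR (qclass N)).
by split=> [/commgP/eqP|/eqP/commgP].
Qed.

(* The torsion elements of the nilpotent group [G / lcs n] form a subgroup,   *)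
(* by descending induction on [s] for elements commuting modulo [lcs s].      *)
Lemma ilcsM_aux n d s (H : {pred G}) : (n <= s + d)%N ->
  {in H &, forall x y, [~ x, y] \in lcs G s} ->
  {in H &, forall x y, x \in ilcs G n -> y \in ilcs G n -> x * y \in ilcs G n}.
Proof.
elim: d s H => [|d IHd] s H nsd Hs x y xH yH xn yn.
  have /commute_qclass cxy : [~ x, y] \in lcs G n.
    by apply: lcs_le (Hs _ _ xH yH); rewrite addn0 in nsd.
  move: xn yn => /asboolP[k k0 xk] /asboolP[l l0 yl].
  apply/asboolP; exists (k * l)%N; first by rewrite muln_gt0 k0.
  by rewrite gmulfM expgMn// expgnA xk expg1n mulnC expgnA yl expg1n mulg1.
pose K := generated [pred z | (z == y) || (z \in lcs G s)].
have yK : y \in K by apply: mem_generated; rewrite inE eqxx.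
have sK z : z \in lcs G s -> z \in K.
  by move=> zs; apply: mem_generated; rewrite inE zs orbT.
have KJ : {in K, forall t, t ^ x \in K}.
  apply: (@generated_ind _ _ (fun t => t ^ x \in K)).
  - by rewrite conj1g gpred1.
  - by move=> u v ? ?; rewrite conjMg gpredM.
  - by move=> u ?; rewrite conjVg gpredV.
  - move=> z; rewrite inE => /orP[/eqP->|zs]; last by rewrite sK ?lcsJ.
    by rewrite -(mulVKg y (y ^ x)) gpredM// sK// Hs.
have KK : {in K &, forall u v, [~ u, v] \in lcs G s.+1}.
  move=> u v uK vK; apply/commute_qclass; move: u uK.
  apply: generated_ind => [|a b ca cb|a ca|a aA].
  - by rewrite morph1; apply/commute_sym/commute1.
  - by rewrite gmulfM; apply/commute_sym/commuteM; apply/commute_sym.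
  - by rewrite morphV; apply/commute_sym/commuteV/commute_sym.
  move: v vK; apply: generated_ind => [|b e cb ce|b cb|b bA].
  - by rewrite morph1; apply/commute1.
  - by rewrite gmulfM; apply/commuteM.
  - by rewrite morphV; apply/commuteV.
  move: aA bA; rewrite !inE => /orP[/eqP->|za] /orP[/eqP->|zb] //.
  - by apply/commute_sym/commute_qclass/lcsR.
  - by apply/commute_qclass/lcsR.
  - by apply/commute_qclass/lcsR.
have IHK : {in K &, forall u v,
    u \in ilcs G n -> v \in ilcs G n -> u * v \in ilcs G n}.
  by apply: (IHd s.+1) => //; rewrite addSnnS.
have powxy m : exists t, [/\ t \in K, t \in ilcs G n & (x * y) ^+ m = x ^+ m * t].
  elim: m => [|m [t [tK tn e]]].
    exists 1; split; rewrite ?gpred1 ?mulg1//.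
    by apply/ilcsP; exists 1%N; rewrite ?gpred1.
  exists (t ^ x * y); split; first by rewrite gpredM ?KJ.
    apply: IHK => //; first exact: KJ.
    have [k k0 tk] := (ilcsP n t).1 tn.
    by apply/ilcsP; exists k; rewrite // -conjXg lcsJ.
  by rewrite !expgSr e /conjg !mulgA mulgK.
have [k k0 xk] := (ilcsP n x).1 xn; have [t [_ tn e]] := powxy k.
have [l l0 tl] := (ilcsP n t).1 tn.
apply/ilcsP; exists (k * l)%N; first by rewrite muln_gt0 k0.
have /qclass_eq1 qxk := xk.
apply/qclass_eq1; rewrite expgnA e (morphX (qclass _)) gmulfM /= qxk.
by rewrite mul1g -(morphX (qclass _)); apply/qclass_eq1.
Qed.

Fact ilcsM n : mulg_closed (ilcs G n).
Proof. by move=> x y; apply: (@ilcsM_aux n n 0 predT). Qed.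
Fact ilcs1 n : 1 \in ilcs G n.
Proof. by apply/ilcsP; exists 1%N; rewrite ?gpred1. Qed.
Fact ilcsV n : invg_closed (ilcs G n).
Proof.
by move=> x /ilcsP[k k0 xk]; apply/ilcsP; exists k; rewrite // expVgn gpredV.
Qed.
Fact ilcsJ n : {in ilcs G n, forall x y, x ^ y \in ilcs G n}.
Proof.
move=> x /ilcsP[k k0 xk] y; apply/ilcsP; exists k => //.
by rewrite -conjXg lcsJ.
Qed.

HB.instance Definition _ n := isMulClosed.Build G (ilcs G n) (@ilcsM n).
HB.instance Definition _ n := isMul1Closed.Build G (ilcs G n) (ilcs1 n).
HB.instance Definition _ n := isInvClosed.Build G (ilcs G n) (@ilcsV n).
HB.instance Definition _ n := isConjClosed.Build G (ilcs G n) (@ilcsJ n).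

End IsolatedLowerCentralSeries.

Section Factors.
Variable G : groupType.

Definition ilcs_next (n : nat) : {pred subgroup_of (ilcs G n)} :=
  [pred u | val u \in ilcs G n.+1].
Arguments ilcs_next n : clear implicits.

Lemma ilcs_nextE n u : (u \in ilcs_next n) = (val u \in ilcs G n.+1).
Proof. by []. Qed.

Fact ilcs_nextM n : mulg_closed (ilcs_next n).
Proof. by move=> u v; rewrite !ilcs_nextE valM; exact: gpredM. Qed.
Fact ilcs_next1 n : 1 \in ilcs_next n.
Proof. by rewrite ilcs_nextE val1 gpred1. Qed.
Fact ilcs_nextV n : invg_closed (ilcs_next n).
Proof. by move=> u; rewrite !ilcs_nextE (morphV val) gpredV. Qed.
Fact ilcs_nextJ n : {in ilcs_next n, forall u v, u ^ v \in ilcs_next n}.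
Proof. by move=> u un v; rewrite ilcs_nextE (morphJ val) conj_closed. Qed.

HB.instance Definition _ n := isMulClosed.Build _ (ilcs_next n) (@ilcs_nextM n).
HB.instance Definition _ n := isMul1Closed.Build _ (ilcs_next n) (ilcs_next1 n).
HB.instance Definition _ n := isInvClosed.Build _ (ilcs_next n) (@ilcs_nextV n).
HB.instance Definition _ n := isConjClosed.Build _ (ilcs_next n) (@ilcs_nextJ n).

(* The quotient [ilcs n / ilcs n.+1]. *)
Definition ilcs_factor (n : nat) : groupType := qgroup (ilcs_next n).

Section Induced.
Variables (f : {multiplicative G -> G}) (n : nat).

Fact ilcs_endo_subproof m x : x \in ilcs G m -> f x \in ilcs G m.
Proof.
by move=> /ilcsP[k k0 xk]; apply/ilcsP; exists k; rewrite // -morphX lcs_endo.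
Qed.

Definition ilcs_endo (u : subgroup_of (ilcs G n)) : subgroup_of (ilcs G n) :=
  Sub (f (val u)) (ilcs_endo_subproof (valP u)).

Fact ilcs_endoM : {morph ilcs_endo : u v / u * v}.
Proof.
by move=> u v; apply: val_inj; exact: (gmulfM (val u) (val v)).
Qed.

HB.instance Definition _ := isMultiplicative.Build _ _ ilcs_endo ilcs_endoM.

Definition induced (X : ilcs_factor n) : ilcs_factor n :=
  qclass (ilcs_next n) (ilcs_endo (repr X)).

Lemma inducedE u :
  induced (qclass (ilcs_next n) u) = qclass (ilcs_next n) (ilcs_endo u).
Proof.
apply/qclass_eq; rewrite -(morphV ilcs_endo) -gmulfM ilcs_nextE SubK.
by apply: ilcs_endo_subproof; apply: (qclass_repr (ilcs_next n) u).
Qed.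

Fact inducedM : {morph induced : X Y / X * Y}.
Proof.
move=> X Y; have [x <-] := qclass_surj X; have [y <-] := qclass_surj Y.
by rewrite -gmulfM !inducedE gmulfM gmulfM.
Qed.

HB.instance Definition _ :=
  isMultiplicative.Build (ilcs_factor n) (ilcs_factor n) induced inducedM.

End Induced.
End Factors.
Arguments ilcs_factor G n : clear implicits.
Arguments ilcs_endo {G} f n u.
Arguments induced {G} f n X.

Section TwistedConjugacy.
Variables (G : groupType) (phi psi : {multiplicative G -> G}).

Definition twisted_conj (x y : G) : Prop :=
  exists g : G, x = (phi g)^-1 * y * psi g.

Lemma twisted_conj_refl x : twisted_conj x x.
Proof. by exists 1; rewrite !morph1 invg1 mul1g mulg1. Qed.

Lemma twisted_conj_sym x y : twisted_conj x y -> twisted_conj y x.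
Proof.
move=> [g ->]; exists g^-1.
by rewrite !morphV invgK !mulgA mulgV mul1g mulgK.
Qed.

Lemma twisted_conj_trans x y z :
  twisted_conj x y -> twisted_conj y z -> twisted_conj x z.
Proof. by move=> [g ->] [h ->]; exists (h * g); rewrite !gmulfM invgM !mulgA. Qed.

Definition twisted_classes : set (set G) :=
  [set [set x | twisted_conj x y] | y in [set: G]].

(* Meaningful only when [twisted_classes] is finite. *)
Definition reidemeister_number : nat := #|` fset_set twisted_classes|%fset.

Definition Coin : set G := [set x | phi x = psi x].

End TwistedConjugacy.

(* Main.v *)
Require Import Defs.
From HB Require Import structures.
From mathcomp Require Import all_boot all_algebra.
From mathcomp Require Import finmap.
From mathcomp Require Import boolp classical_sets functions cardinality.

Set Implicit Arguments.
Unset Strict Implicit.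
Unset Printing Implicit Defensive.

Import Algebra.

Local Open Scope classical_set_scope.
Local Open Scope group_scope.

(** Write N_i for the i-th isolated lower central subgroup, with N_0 = G. In a
torsion-free nilpotent group roots are unique (lemma [isolated_root_unique]),
which makes the series N_i central ([ilcs_central]). Two consequences of
centrality carry both parts. First, a relation y a = (g phi)^-1 (y b) (g psi)
with a, b, g in N_i reads, modulo N_(i+1), as the same relation between a and b
alone ([twisted_shift]). Secondly, if the coincidence sets of the factors before
the i-th one are trivial, then any g satisfying such a relation with a, b in N_i
already lies in N_i ([twisted_descent]): if g is in N_j for some j < i, then
modulo N_(j+1) the relation says that g is a coincidence of the j-th factor.

Part (1), by strong induction on i. Once the earlier coincidence sets are
trivial, elements of N_i that are twisted conjugate in G are so by an element of
N_i, hence the i-th factor has at most R(phi, psi) classes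
([factor_classes_finite]). It remains to treat a torsion-free abelian group A of
finite rank with finitely many classes ([Coin_abelian]). Let delta be the
difference of the two endomorphisms. Two powers of any element lie in the same
class, so every element has a positive power in the image of delta. If delta had
a non-trivial kernel, one could prepend a kernel element to preimages of powers
of a Z-independent family and obtain a longer one; independent families would be
arbitrarily large ([kernel_z_free]), against the finite rank ([z_free_leq]).

Part (2). Choose in N_i a representative of each twisted class of the i-th
factor. Every element of G is twisted conjugate to exactly one product
t_0 t_1 ... t_(c-1) of such representatives. For existence, the remainder in N_i
is reduced to its representative modulo N_(i+1), one factor at a time
([twisted_reduce]); for uniqueness, descent and shift recover the class of t_i
from the earlier ones ([normal_form_inj]). Sending a family of classes to the
class of its product is therefore the bijection, and counting families gives the
product formula. *)

(** * The isolated lower central series is central *)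

Section IsolatedSeries.
Variable G : groupType.

Lemma commute_root_unique (N : normalClosed G) (a b : G) k :
    (forall (x : G) l, (0 < l)%N -> x ^+ l \in N -> x \in N) ->
    [~ a, b] \in N -> (0 < k)%N ->
  qclass N a ^+ k = qclass N b ^+ k -> qclass N a = qclass N b.
Proof.
move=> isoN /commute_qclass cab k0 ab.
apply/divg1_eq; rewrite -(gmulfF (qclass N)); apply/qclass_eq1.
apply: (isoN _ k) => //; apply/qclass_eq1.
by rewrite (morphX (qclass N)) (gmulfF (qclass N)) expgnFl //= ab mulgV.
Qed.

(** Uniqueness of roots modulo N, by descending induction on the depth s of the
commutator of a and b in the lower central series. The elements a and a ^ b have
the same k-th power modulo N, because b commutes with b ^+ k, and the commutator
of a and a ^ b, equal to that of a and [~ a, b], lies one step deeper. So a and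
a ^ b agree modulo N: a and b commute there, and roots of commuting elements
are unique as N is isolated. *)
Lemma isolated_root_unique (N : normalClosed G) m d s (a b : G) k :
    (forall (x : G) l, (0 < l)%N -> x ^+ l \in N -> x \in N) ->
    {subset lcs G m <= N} -> (m <= s + d)%N -> [~ a, b] \in lcs G s ->
    (0 < k)%N ->
  qclass N a ^+ k = qclass N b ^+ k -> qclass N a = qclass N b.
Proof.
move=> isoN lcsN + + k0; elim: d s b => [|d IHd] s b ms abs ab.
  apply: (commute_root_unique isoN _ k0 ab).
  by apply/lcsN; apply: lcs_le abs; rewrite addn0 in ms.
apply: (commute_root_unique isoN _ k0 ab); apply/commute_qclass.
suff e : qclass N a = qclass N (a ^ b).
  by apply/commgP/conjg_fixP; rewrite -(morphJ (qclass N)); exact/esym.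
apply: (IHd s.+1); first by rewrite addSnnS.
- have -> : a ^ b = a * [~ a, b] by rewrite commgEl mulVKg.
  have -> z : [~ a, a * z] = [~ z, a]^-1.
    by rewrite invgR /commg /conjg invgM !mulgA mulgVK.
  by rewrite gpredV lcsR.
- rewrite (morphJ (qclass N)) -conjXg /= ab conjXg.
  by congr (_ ^+ k); apply/esym; rewrite /conjg mulKg.
Qed.

Lemma ilcs_isolated n (x : G) k :
  (0 < k)%N -> x ^+ k \in ilcs G n -> x \in ilcs G n.
Proof.
move=> k0 /ilcsP[l l0 xkl]; apply/ilcsP; exists (k * l)%N.
  by rewrite muln_gt0 k0.
by rewrite expgnA.
Qed.

Lemma lcs_sub_ilcs n : {subset lcs G n <= ilcs G n}.
Proof. by move=> x xn; apply/ilcsP; exists 1%N. Qed.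

Lemma ilcs_sub n : {subset ilcs G n.+1 <= ilcs G n}.
Proof. by move=> x /ilcsP[k k0 /lcs_sub xk]; apply/ilcsP; exists k. Qed.

Lemma ilcs_le m n : (m <= n)%N -> {subset ilcs G n <= ilcs G m}.
Proof.
by move=> mn x /ilcsP[k k0 /(lcs_le mn) xk]; apply/ilcsP; exists k.
Qed.

Lemma ilcs0 (x : G) : x \in ilcs G 0.
Proof. by apply/ilcsP; exists 1%N. Qed.

Lemma ilcs_last c : torsion_free G -> nilpotent_of_class G c ->
  forall x, x \in ilcs G c -> x = 1.
Proof.
move=> tfG [c1 _] x /ilcsP[k k0]; rewrite c1 inE => /eqP xk.
by apply/tfG/asboolP; exists k.
Qed.

(** Modulo the next term, a power of x is central; hence x and x ^ y have a power
in common, and they agree by uniqueness of roots. *)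
Lemma ilcs_central n (x y : G) : x \in ilcs G n ->
  commute (qclass (ilcs G n.+1) x) (qclass (ilcs G n.+1) y).
Proof.
move=> /ilcsP[k k0 xk]; set q := qclass _; apply/commgP/conjg_fixP.
rewrite -(morphJ q); apply/esym.
apply: (@isolated_root_unique _ n.+1 n.+1 0 _ _ k) => //.
- exact: ilcs_isolated.
- exact: lcs_sub_ilcs.
rewrite (morphJ q) -conjXg -(morphX q); apply/esym/conjg_fixP/commgP.
by apply/commute_qclass/lcs_sub_ilcs/lcsR.
Qed.

Lemma ilcs_factorC n (X Y : ilcs_factor G n) : commute X Y.
Proof.
have [x <-] := qclass_surj X; have [y <-] := qclass_surj Y.
apply/commute_qclass; rewrite ilcs_nextE (morphR val); apply/commute_qclass.
exact/ilcs_central/valP.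
Qed.

Lemma ilcs_factor_torsion_free n : torsion_free (ilcs_factor G n).
Proof.
move=> X; have [x <-] := qclass_surj X => /asboolP[k k0].
rewrite -(morphX (qclass _)) => /qclass_eq1; rewrite ilcs_nextE (morphX val).
by move=> /(ilcs_isolated k0) xn; apply/qclass_eq1.
Qed.

End IsolatedSeries.

(** * Twisted conjugacy along the series *)

Section TwistedSeries.
Variables (G : groupType) (phi psi : {multiplicative G -> G}).

Lemma qclass_factorP n (u v : subgroup_of (ilcs G n)) :
  qclass (@ilcs_next G n) u = qclass (@ilcs_next G n) v <->
  qclass (ilcs G n.+1) (val u) = qclass (ilcs G n.+1) (val v).
Proof. by rewrite !qclass_eq ilcs_nextE valM (morphV val). Qed.

Lemma Coin_inducedP n :
  Coin (induced phi n) (induced psi n) = [set 1] <->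
  (forall g, g \in ilcs G n ->
     qclass (ilcs G n.+1) (phi g) = qclass (ilcs G n.+1) (psi g) ->
     g \in ilcs G n.+1).
Proof.
split=> [C1 g gn e|H].
  pose u : subgroup_of (ilcs G n) := Sub g gn.
  have : Coin (induced phi n) (induced psi n) (qclass _ u).
    by rewrite /Coin /= !inducedE; apply/qclass_factorP; rewrite !SubK.
  by rewrite C1 => /qclass_eq1; rewrite ilcs_nextE SubK.
apply/seteqP; split=> [X|X ->]; last first.
  by rewrite /Coin /= !morph1.
have [u <-] := qclass_surj X; rewrite /Coin /= !inducedE => /qclass_factorP.
by rewrite !SubK => /H un; apply/qclass_eq1; rewrite ilcs_nextE un ?(valP u).
Qed.

Lemma qclass_twist n (w v : subgroup_of (ilcs G n)) :
  (induced phi n (qclass _ w))^-1 * qclass (@ilcs_next G n) v *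
    induced psi n (qclass _ w) =
  qclass (@ilcs_next G n) ((ilcs_endo phi n w)^-1 * v * ilcs_endo psi n w).
Proof. by rewrite !inducedE !gmulfM (morphV (qclass _)). Qed.

Lemma twisted_conj_inducedP n (u v : subgroup_of (ilcs G n)) :
  twisted_conj (induced phi n) (induced psi n)
    (qclass (@ilcs_next G n) u) (qclass (@ilcs_next G n) v) <->
  exists2 g, g \in ilcs G n &
    qclass (ilcs G n.+1) (val u) =
    qclass (ilcs G n.+1) ((phi g)^-1 * val v * psi g).
Proof.
split=> [[X]|[g gn e]].
  have [w <-] := qclass_surj X; rewrite qclass_twist => /qclass_factorP.
  by rewrite !valM (morphV val) !SubK => e; exists (val w); rewrite ?(valP w).
exists (qclass _ (Sub g gn)); rewrite qclass_twist; apply/qclass_factorP.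
by rewrite !valM (morphV val) !SubK.
Qed.

(** The image of g under phi is central modulo the next term, so it moves past
the common prefix y, which can then be cancelled. *)
Lemma twisted_shift n (y a b g : G) : g \in ilcs G n ->
  qclass (ilcs G n.+1) (y * a) =
    qclass (ilcs G n.+1) ((phi g)^-1 * (y * b) * psi g) <->
  qclass (ilcs G n.+1) a =
    qclass (ilcs G n.+1) ((phi g)^-1 * b * psi g).
Proof.
move=> gn; rewrite -mulgA !gmulfM (morphV (qclass _)).
have cy : commute (qclass (ilcs G n.+1) (phi g)^-1) (qclass (ilcs G n.+1) y).
  by apply: ilcs_central; rewrite gpredV ilcs_endo_subproof.
rewrite (morphV (qclass _)) in cy; rewrite !mulgA cy -!mulgA.
by split=> [/mulgI|/(congr1 (monoid.mul _))]; apply.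
Qed.

(** As long as g lies in an earlier term of the series, a and b vanish modulo the
next term and the relation makes g a coincidence of that factor. *)
Lemma twisted_descent n (y a b g : G) :
    (forall j, (j < n)%N -> Coin (induced phi j) (induced psi j) = [set 1]) ->
    a \in ilcs G n -> b \in ilcs G n ->
  y * a = (phi g)^-1 * (y * b) * psi g -> g \in ilcs G n.
Proof.
move=> C1 an bn e; suff H j : (j <= n)%N -> g \in ilcs G j by exact: H.
elim: j => [|j IHj] jn; first exact: ilcs0.
have gj := IHj (ltnW jn); have /Coin_inducedP := C1 j jn; apply=> //.
have := congr1 (qclass (ilcs G j.+1)) e; rewrite (twisted_shift _ _ _ gj).
have /qclass_eq1 -> := ilcs_le jn an; have /qclass_eq1 b1 := ilcs_le jn bn.
rewrite !gmulfM /= b1 mulg1 (morphV (qclass _)) => /esym.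
move=> /(congr1 (monoid.mul (qclass _ (phi g)))).
by rewrite mulVKg mulg1.
Qed.

End TwistedSeries.

(** * Z-independent families *)

Section IntegralIndependence.
Import GRing.Theory Num.Theory.
Local Open Scope ring_scope.

Lemma rat_row_scale n (w : 'rV[rat]_n) :
  exists2 d : int, d != 0 &
    exists v : 'I_n -> int, forall i, (v i)%:~R = w 0 i * d%:~R.
Proof.
exists (\prod_j denq (w 0 j)); first by apply/prodf_neq0 => j _; rewrite denq_neq0.
exists (fun i => numq (w 0 i) * \prod_(j | j != i) denq (w 0 j)) => i.
rewrite [in RHS](bigD1 i) //= !intrM mulrA; congr (_ * _).
by rewrite -{2}(divq_num_den (w 0 i)) mulfVK // intr_eq0 denq_neq0.
Qed.

Definition z_free (V : zmodType) n (e : 'I_n -> V) : Prop :=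
  forall v : 'I_n -> int, \sum_i e i *~ v i = 0 -> forall i, v i = 0.

(** A matrix of integers with more rows than columns has a non-zero rational row
relation; clearing denominators makes it integral. *)
Lemma z_free_leq (V : zmodType) n r (e : 'I_n -> V) (t : 'I_r -> V) :
  (forall i, exists m : 'I_r -> int, e i = \sum_j t j *~ m j) ->
  z_free e -> (n <= r)%N.
Proof.
move=> /choice[M eM] free_e; rewrite leqNgt; apply/negP => rn.
pose Mq : 'M[rat]_(n, r) := \matrix_(i, j) (M i j)%:~R.
have /rowV0Pn[w /sub_kermxP wM w0] : kermx Mq != 0.
  rewrite kermx_eq0 /row_free; apply: contraL rn => /eqP rk.
  by rewrite -leqNgt -rk rank_leq_col.
have [d d0 [v vw]] := rat_row_scale w.
have vM j : \sum_i M i j * v i = 0.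
  apply: (@intr_inj rat); rewrite rmorph_sum /=.
  have /matrixP/(_ 0 j) := wM; rewrite !mxE => /(congr1 ( *%R^~ d%:~R)).
  rewrite mul0r mulr_suml => wMd; apply: etrans wMd; apply: eq_bigr => i _.
  by rewrite intrM vw !mxE mulrCA mulrA.
have v0 : forall i, v i = 0.
  apply: free_e; under eq_bigr do rewrite eM mulrz_suml.
  rewrite exchange_big big1 //= => j _.
  by under eq_bigr do rewrite -mulrzA; rewrite -mulrz_sumr vM.
move/eqP: w0; apply; apply/rowP => i; rewrite mxE.
have /eqP := vw i; rewrite v0 eq_sym mulf_eq0 intr_eq0 (negPf d0) orbF.
by move/eqP.
Qed.

(** From an independent family e, with positive multiples of its members equal to
the values of delta at f, the family x, f is independent: applying delta to a
relation removes x and leaves one between the e i; what remains is a multiple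
of x, and there is no torsion. *)
Lemma kernel_z_free (V : zmodType) (delta : {additive V -> V}) (x : V) :
  (forall (y : V) k, (0 < k)%N -> y *+ k = 0 -> y = 0) ->
  (forall y : V, exists2 k, (0 < k)%N & exists z, y *+ k = delta z) ->
  x != 0 -> delta x = 0 -> forall n, exists e : 'I_n -> V, z_free e.
Proof.
move=> tfV dV x0 dx; elim=> [|n [e free_e]].
  by exists (fun=> 0) => v _ [].
have /choice[k] : forall i, exists k, (0 < k)%N /\ exists z, e i *+ k = delta z.
  by move=> i; have [k k0 ez] := dV (e i); exists k.
move=> /all_and2[k0 /choice[f ef]].
exists (fun i => oapp f x (unlift ord0 i)) => v.
rewrite big_ord_recl unlift_none /=; under eq_bigr do rewrite liftK /=.
move=> sum0; have v0 i : v (lift ord0 i) = 0.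
  have : (k i)%:Z * v (lift ord0 i) = 0.
    apply: (free_e (fun i => (k i)%:Z * v (lift ord0 i))).
    have := congr1 delta sum0; rewrite raddfD /= raddfMz dx mul0rz add0r raddf0.
    rewrite raddf_sum => sumd; apply: etrans sumd; apply: eq_bigr => j _.
    by rewrite mulrzA -pmulrn ef raddfMz.
  by move/eqP; rewrite mulf_eq0 eqz_nat -leqn0 leqNgt k0 => /eqP.
move=> i; have [->|[j ->]] // : i = ord0 \/ exists j, i = lift ord0 j.
  by case: (unliftP ord0 i) => [j|] ->; [right; exists j | left].
move: sum0; rewrite big1 ?addr0 => [|j _]; last by rewrite v0 mulr0z.
case: (v ord0) => [[|p]|p] //=; rewrite ?NegzE ?mulrNz -?pmulrn.
  by move=> /tfV xe; rewrite xe ?eqxx in x0.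
by move/eqP; rewrite oppr_eq0 => /eqP/tfV xe; rewrite xe ?eqxx in x0.
Qed.

End IntegralIndependence.

(** * The additive group of a commutative group *)

(** A copy of A, so that the multiplicative group A can be seen as an additive one
and used with integer scalars and matrices; the commutation proof is a parameter
because the instances below depend on it. *)
Definition additive_of (A : groupType) of (forall x y : A, commute x y) : Type :=
  A.

Section AdditiveOf.
Variables (A : groupType) (cA : forall x y : A, commute x y).

HB.instance Definition _ := Choice.on (additive_of cA).

Fact additive_ofA : @associative (additive_of cA) (fun x y : A => x * y).
Proof. exact: mulgA. Qed.
Fact additive_ofC : @commutative (additive_of cA) _ (fun x y : A => x * y).
Proof. exact: cA. Qed.
Fact additive_of0 : @left_id (additive_of cA) _ 1 (fun x y : A => x * y).
Proof. exact: mul1g. Qed.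
Fact additive_ofN :
  @left_inverse (additive_of cA) _ _ 1 (fun x : A => x^-1) (fun x y : A => x * y).
Proof. exact: mulVg. Qed.

HB.instance Definition _ := GRing.isZmodule.Build (additive_of cA)
  additive_ofA additive_ofC additive_of0 additive_ofN.

Lemma additive_ofX (x : additive_of cA) k : (x *+ k)%R = (x : A) ^+ k.
Proof. by elim: k => [|k IHk] //; rewrite GRing.mulrS expgS IHk. Qed.

Lemma generated_span (t : seq A) (x : A) : x \in generated (mem t) ->
  exists m : 'I_(size t) -> int,
    x = (\sum_(j < size t) ((nth 1%g t j : additive_of cA) *~ m j))%R.
Proof.
move: x; apply: generated_ind => [|x y [m ->] [p ->]|x [m ->]|x xt].
- by exists (fun=> 0%R); rewrite big1 // => j _; rewrite mulr0z.
- exists (fun j => m j + p j)%R; rewrite -[LHS]/(_ + _)%R -big_split /=.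
  by apply: eq_bigr => j _; rewrite mulrzDr.
- exists (fun j => - m j)%R; rewrite -[LHS]/(- _)%R -GRing.sumrN.
  by apply: eq_bigr => j _; rewrite mulrNz.
have jt : (index x t < size t)%N by rewrite index_mem.
exists (fun j => Posz (j == Ordinal jt)).
rewrite (bigD1 (Ordinal jt)) //= eqxx mulr1z nth_index // big1 ?GRing.addr0 //.
by move=> j /negPf ->; rewrite mulr0z.
Qed.

Lemma additive_of_z_free : finite_rank A ->
  exists r, forall n (e : 'I_n -> additive_of cA), z_free e -> (n <= r)%N.
Proof.
move=> [r rA]; exists r => n e; have [t tr te] := rA [seq (e i : A) | i : 'I_n].
move=> free_e; apply: leq_trans tr; apply: z_free_leq free_e => i.
apply/generated_span; rewrite te; apply: mem_generated.
by apply: (map_f (fun i => e i : A)); rewrite mem_enum.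
Qed.

End AdditiveOf.

(** * Groups of finite rank *)

Section FiniteRank.
Variables (G H : groupType) (f : {multiplicative G -> H}).

Lemma generated_map (s : seq G) (y : H) :
  y \in generated (mem (map f s)) <-> exists2 x, x \in generated (mem s) & y = f x.
Proof.
split=> [|[x + ->{y}]].
  move: y; apply: generated_ind.
  - by exists 1; rewrite ?gpred1 ?morph1.
  - by move=> _ _ [x xs ->] [y ys ->]; exists (x * y); rewrite ?gpredM ?gmulfM.
  - by move=> _ [x xs ->]; exists x^-1; rewrite ?gpredV ?morphV.
  - by move=> _ /mapP[x xs ->]; exists x; rewrite ?mem_generated.
move: x; apply: generated_ind => [|x y xs ys|x xs|x xs].
- by rewrite morph1 gpred1.
- by rewrite gmulfM gpredM.
- by rewrite morphV gpredV.
- by apply: mem_generated; apply: map_f.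
Qed.

Lemma seq_in_image (t : seq H) :
  (forall y, y \in t -> exists x, y = f x) -> exists s, t = map f s.
Proof.
elim: t => [|y t IHt] ft; first by exists [::].
have [x ->] := ft y (mem_head _ _).
have [|s ->] := IHt; first by move=> z zt; apply: ft; rewrite inE zt orbT.
by exists (x :: s).
Qed.

Lemma finite_rank_inj : injective f -> finite_rank H -> finite_rank G.
Proof.
move=> f_inj [r rH]; exists r => s; have [t tr ts] := rH (map f s).
have [y yt|t' e] := @seq_in_image t.
  have : y \in generated (mem t) by exact: mem_generated.
  by rewrite ts => /generated_map[x _ ->]; exists x.
exists t'; first by move: tr; rewrite e size_map.
have sub s1 s2 x : generated (mem (map f s1)) =i generated (mem (map f s2)) ->
    x \in generated (mem s1) -> x \in generated (mem s2).
  move=> e12 xs; have : f x \in generated (mem (map f s1)).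
    by apply/generated_map; exists x.
  by rewrite e12 => /generated_map[x' xs' /f_inj->].
by move=> x; apply/idP/idP; apply: sub; rewrite -e // => y; rewrite ts.
Qed.

Lemma finite_rank_surj : (forall y, exists x, y = f x) ->
  finite_rank G -> finite_rank H.
Proof.
move=> f_surj [r rG]; exists r => s.
have [|s' ->] := @seq_in_image s; first by move=> y _; exact: f_surj.
have [t tr ts] := rG s'; exists (map f t); first by rewrite size_map.
by move=> y; apply/idP/idP => /generated_map[x xs ->];
   apply/generated_map; exists x; rewrite // ?ts // -ts.
Qed.

End FiniteRank.

Lemma ilcs_factor_finite_rank (G : groupType) n :
  finite_rank G -> finite_rank (ilcs_factor G n).
Proof.
move=> rG; apply: (@finite_rank_surj _ _ (qclass (@ilcs_next G n))).
  by move=> X; have [x <-] := qclass_surj X; exists x.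
exact: (finite_rank_inj (@val_inj _ _ (subgroup_of (ilcs G n)))).
Qed.

(** * Finiteness of the number of classes and coincidences *)

Lemma finite_set_repeat T (B : set T) (F : nat -> T) : finite_set B ->
  (forall k, B (F k)) -> exists k l, (k < l)%N /\ F k = F l.
Proof.
move=> finB BF; apply: contrapT => noF; apply: infinite_nat.
suff F_inj : {in [set: nat] &, injective F}.
  rewrite -(eq_finite_set (inj_card_eq F_inj)); apply: sub_finite_set finB.
  by move=> _ [k _ <-].
by move=> k l _ _ e; case: (ltngtP k l) => // kl; exfalso; apply: noF;
  [exists k, l | exists l, k].
Qed.

(** A non-trivial coincidence is a kernel element of the difference delta of f and
h. Two powers of y with exponents k < l in the same class give, by commutativity,
y ^+ (l - k) in the image of delta, so delta would produce arbitrarily large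
independent families. *)
Lemma Coin_abelian (A : groupType) (f h : {multiplicative A -> A}) :
    (forall x y : A, commute x y) -> torsion_free A -> finite_rank A ->
  finite_set (twisted_classes f h) -> Coin f h = [set 1].
Proof.
move=> cA tfA /(additive_of_z_free cA)[r rA] finfh.
pose delta (x : additive_of cA) : additive_of cA := f x * (h x)^-1.
have deltaB : GRing.zmod_morphism delta.
  move=> x y; rewrite /delta.
  have fB (k : {multiplicative A -> A}) :
      (k (x - y)%R = (k x : additive_of cA) - (k y : additive_of cA))%R.
    by rewrite -[(x - y)%R]/((x : A) * (y : A)^-1) gmulfM morphV.
  rewrite -[LHS]/((f (x - y)%R : additive_of cA) -
    (h (x - y)%R : additive_of cA))%R !fB.
  rewrite -[RHS]/(((f x : additive_of cA) - (h x : additive_of cA)) -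
    ((f y : additive_of cA) - (h y : additive_of cA)))%R.
  rewrite !GRing.opprB -!GRing.addrA; congr (_ + _)%R.
  by rewrite GRing.addrCA [RHS]GRing.addrCA; congr (_ + _)%R; apply: GRing.addrC.
pose d : {additive additive_of cA -> additive_of cA} :=
  HB.pack delta (GRing.isZmodMorphism.Build _ _ delta deltaB).
apply/seteqP; split=> [x|x ->]; rewrite /Coin /= ?morph1 // => fh.
apply: contrapT => x1.
suff [e] : exists e : 'I_r.+1 -> additive_of cA, z_free e.
  by move=> /rA; rewrite ltnn.
apply: (@kernel_z_free _ d x).
- move=> y k k0; rewrite additive_ofX => yk.
  by apply/tfA/asboolP; exists k.
- move=> y; pose F k := [set z | twisted_conj f h z ((y : A) ^+ k)].
  have [k [l [kl Fkl]]] : exists k l, (k < l)%N /\ F k = F l.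
    by apply: finite_set_repeat finfh _ => k; exists (y ^+ k).
  have : F l (y ^+ k) by rewrite -Fkl; exact: twisted_conj_refl.
  move=> [g e]; exists (l - k)%N; first by rewrite subn_gt0.
  exists g; rewrite additive_ofX expgnFr ?(ltnW kl) //=.
  have -> : y ^+ l = f g * (h g)^-1 * y ^+ k.
    by rewrite e (cA _ (h g)) -mulgA mulKg mulVKg.
  by rewrite mulgK.
- by apply/eqP.
- by rewrite /d /= /delta fh mulgV.
Qed.

Section FiniteClasses.
Variables (G : groupType) (phi psi : {multiplicative G -> G}).

(** The class of an element of the factor is the image of the trace on
[ilcs G n] of the class in G of any lift: by descent, lifts that are twisted
conjugate in G are so by an element of [ilcs G n]. *)
Lemma factor_classes_finite n :
    (forall j, (j < n)%N -> Coin (induced phi j) (induced psi j) = [set 1]) ->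
    finite_set (twisted_classes phi psi) ->
  finite_set (twisted_classes (induced phi n) (induced psi n)).
Proof.
move=> C1 finG; pose q := qclass (@ilcs_next G n).
pose restr (D : set G) : set (ilcs_factor G n) :=
  [set X | exists2 u : subgroup_of (ilcs G n), D (val u) & q u = X].
apply: sub_finite_set (finite_image restr finG) => _ [Y _ <-].
have [v <-] := qclass_surj Y; exists [set x | twisted_conj phi psi x (val v)].
  by exists (val v).
apply/seteqP; split=> [X [u [g uv] <-] | X [Z ->]].
  apply/twisted_conj_inducedP; exists g; last by rewrite uv.
  apply: (twisted_descent (y := 1) C1 (valP u) (valP v)).
  by rewrite !mul1g uv.
have [w <-] := qclass_surj Z.
exists ((ilcs_endo phi n w)^-1 * v * ilcs_endo psi n w).
  by exists (val w); rewrite !valM (morphV val) !SubK.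
exact/esym/qclass_twist.
Qed.

Lemma Coin_factors : finite_rank G -> finite_set (twisted_classes phi psi) ->
  forall n, Coin (induced phi n) (induced psi n) = [set 1].
Proof.
move=> rG finG; elim/ltn_ind => n IHn; apply: Coin_abelian.
- exact: ilcs_factorC.
- exact: ilcs_factor_torsion_free.
- exact: ilcs_factor_finite_rank.
- exact: factor_classes_finite.
Qed.

End FiniteClasses.

(** * Cardinality of dependent products *)

Section Cardinality.
Local Open Scope card_scope.

Lemma card_eq_finType (T : finType) : [set: T] #= `I_#|T|.
Proof.
rewrite (card_eqr card_II) card_eq_sym.
have <- : enum_val @` [set: 'I_#|T|] = [set: T].
  by apply/seteqP; split=> // x _; exists (enum_rank x); rewrite ?enum_rankK.
by rewrite card_eq_sym; apply: inj_card_eq => i j _ _; apply: enum_val_inj.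
Qed.

Lemma card_eq_dprod (I : finType) (T : I -> pointedType)
    (A : forall i, set (T i)) (n : I -> nat) :
  (forall i, A i #= `I_(n i)) ->
  [set C : forall i, T i | forall i, A i (C i)] #= `I_(\prod_i n i)%N.
Proof.
move=> An; have eP i : exists e : nat -> T i, set_bij `I_(n i) (A i) e.
  by apply/card_set_bijP; rewrite card_eq_sym.
pose e i := projT1 (cid (eP i)).
have eA i k : (k < n i)%N -> A i (e i k).
  by have [funA _ _] := projT2 (cid (eP i)); apply: funA.
have e_inj i k l : (k < n i)%N -> (l < n i)%N -> e i k = e i l -> k = l.
  have [_ injA _] := projT2 (cid (eP i)) => kn ln.
  by apply: injA; rewrite inE.
have e_surj i x : A i x -> exists k : 'I_(n i), e i k = x.
  have [_ _ surjA] := projT2 (cid (eP i)) => /surjA[k kn <-].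
  by exists (Ordinal kn).
pose E (h : {dffun forall i, 'I_(n i)}) : forall i, T i := fun i => e i (h i).
have <- : E @` [set: {dffun forall i, 'I_(n i)}] = [set C | forall i, A i (C i)].
  apply/seteqP; split=> [_ [h _ <-] i|C AC]; first exact/eA/ltn_ord.
  pose k i := projT1 (cid (e_surj i (C i) (AC i))).
  have kP i : e i (k i) = C i := projT2 (cid (e_surj i (C i) (AC i))).
  exists [ffun i => k i] => //; apply: functional_extensionality_dep => i.
  by rewrite /E ffunE kP.
have E_inj : {in [set: {dffun forall i, 'I_(n i)}] &, injective E}.
  move=> g h _ _ gh; apply/ffunP => i; apply: val_inj.
  by apply: (@e_inj i); rewrite ?ltn_ord //; apply: (congr1 (fun E => E i) gh).
rewrite (card_eql (inj_card_eq E_inj)).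
have -> : (\prod_i n i)%N = #|{dffun forall i, 'I_(n i)}|.
  rewrite card_dep_ffun foldrE big_map big_enum /=.
  by apply: eq_bigr => i _; rewrite card_ord.
exact: card_eq_finType.
Qed.

Lemma set_bij_inv T U (A : set T) (B : set U) (f : T -> U) (t0 : T) :
  set_bij A B f -> exists g : U -> T, set_bij B A g.
Proof.
move=> [fun_f inj_f surj_f].
have /choice[g gP] : forall y, exists x, B y -> A x /\ f x = y.
  move=> y; case: (pselect (B y)) => [/surj_f[x Ax <-]|nBy]; first by exists x.
  by exists t0.
exists g; split.
- by move=> y /gP[].
- move=> y z; rewrite !inE => /gP[_ fy] /gP[_ fz] e.
  by rewrite -fy -fz e.
- move=> x Ax; have [Agx fg] := gP _ (fun_f _ Ax).
  by exists (f x); [exact: fun_f | apply: inj_f; rewrite ?inE].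
Qed.

Lemma set_bij_card_eq T U (A : set T) (B : set U) (f : T -> U) :
  set_bij A B f -> B #= A.
Proof.
move=> [fun_f inj_f surj_f]; have -> : B = f @` A.
  by apply/seteqP; split=> // _ [x /fun_f Bx <-].
exact: inj_card_eq.
Qed.

End Cardinality.

(** * Normal forms for twisted conjugacy *)

Section NormalForm.
Variables (G : groupType) (c : nat).
Hypotheses (tfG : torsion_free G) (nilG : nilpotent_of_class G c).
Variables phi psi : {multiplicative G -> G}.

Let classes n := twisted_classes (induced phi n) (induced psi n).

Definition class_rep n (C : set (ilcs_factor G n)) : subgroup_of (ilcs G n) :=
  repr (xget 1 C).

Lemma class_repP n C : classes C ->
  C = [set X | twisted_conj (induced phi n) (induced psi n) X
                 (qclass (@ilcs_next G n) (class_rep C))].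
Proof.
move=> [Y _ CY]; rewrite /class_rep /qclass reprK.
have : C (xget 1 C).
  by apply: (xgetI _ (x := Y)); rewrite -CY; exact: twisted_conj_refl.
rewrite -{1 3}CY /= => xY; apply/seteqP; split=> X /= XY.
  by apply: twisted_conj_trans XY _; apply: twisted_conj_sym.
by apply: twisted_conj_trans XY _.
Qed.

(** The value 1 beyond the range makes the family a function on nat, so that the
product can be split at any index. *)
Definition rep_at (C : forall i : 'I_c, set (ilcs_factor G i)) (j : nat) : G :=
  if insub j is Some i then val (class_rep (C i)) else 1.

Definition normal_form C : G := \prod_(0 <= j < c) rep_at C j.

Lemma rep_atE C n (nc : (n < c)%N) :
  rep_at C n = val (class_rep (C (Ordinal nc))).
Proof. by rewrite /rep_at insubT. Qed.

Lemma rep_at_ilcs C n : rep_at C n \in ilcs G n.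
Proof.
rewrite /rep_at; case: insubP => [i _ <-|_]; last exact: gpred1.
exact: (valP (class_rep _)).
Qed.

Lemma normal_form_split C n : (n < c)%N -> exists2 t, t \in ilcs G n.+1 &
  normal_form C = (\prod_(0 <= j < n) rep_at C j) * (rep_at C n * t).
Proof.
move=> nc; exists (\prod_(n.+1 <= j < c) rep_at C j); last first.
  rewrite /normal_form (big_cat_nat (n := n)) ?(ltnW nc) //=.
  by rewrite [in X in _ * X = _]big_ltn.
rewrite big_seq; apply: gpred_prod => j; rewrite mem_index_iota => /andP[nj _].
exact: ilcs_le nj _ (rep_at_ilcs C j).
Qed.

Hypothesis C1 : forall i : 'I_c, Coin (induced phi i) (induced psi i) = [set 1].

(** Suppose that the classes before the n-th one agree. The two products then
share the prefix of length n, and their tails lie in [ilcs G n]; so descent puts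
the conjugating element there, and shifting past the prefix makes it relate the
n-th representatives in the n-th factor. *)
Lemma normal_form_inj C D :
    (forall i, classes (C i)) -> (forall i, classes (D i)) ->
  twisted_conj phi psi (normal_form C) (normal_form D) -> C = D.
Proof.
move=> clC clD [g e].
suff CD n (nc : (n < c)%N) : C (Ordinal nc) = D (Ordinal nc).
  by apply: functional_extensionality_dep => -[n nc].
elim/ltn_ind: n nc => n IHn nc.
have [t tn Ct] := normal_form_split C nc.
have [s sn Ds] := normal_form_split D nc.
have prefix : \prod_(0 <= j < n) rep_at C j = \prod_(0 <= j < n) rep_at D j.
  apply: eq_big_nat => j /andP[_ jn].
  by rewrite !(rep_atE _ (ltn_trans jn nc)) IHn.
rewrite Ct Ds prefix in e.
have inn E u : u \in ilcs G n.+1 -> rep_at E n * u \in ilcs G n.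
  by move=> /ilcs_sub un; rewrite gpredM ?rep_at_ilcs.
have gn : g \in ilcs G n.
  apply: twisted_descent (inn _ _ tn) (inn _ _ sn) e => j jn.
  exact: C1 (Ordinal (ltn_trans jn nc)).
have := congr1 (qclass (ilcs G n.+1)) e; rewrite (twisted_shift _ _ _ _ _ gn).
have /qclass_eq1 t1 := tn; have /qclass_eq1 s1 := sn.
rewrite !gmulfM /= t1 s1 !mulg1 => e'.
have CDn : twisted_conj (induced phi n) (induced psi n)
    (qclass _ (class_rep (C (Ordinal nc))))
    (qclass _ (class_rep (D (Ordinal nc)))).
  apply/twisted_conj_inducedP; exists g => //.
  by rewrite !gmulfM /= -!rep_atE.
rewrite (class_repP (clC _)) (class_repP (clD _)).
apply/seteqP; split=> X /= XY; apply: twisted_conj_trans XY _ => //.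
exact: twisted_conj_sym.
Qed.

(** The remainder a in [ilcs G n] has class representative t, related to a modulo
the next term by some g. Shifting by the prefix y, the same g takes y * t to y * a
up to an element of the next term, and that error becomes the new remainder. *)
Lemma twisted_reduce x n : exists T : nat -> G,
  (forall j, (j < n)%N -> exists2 C, @classes j C & T j = val (class_rep C)) /\
  exists2 a, a \in ilcs G n & twisted_conj phi psi x ((\prod_(0 <= j < n) T j) * a).
Proof.
elim: n => [|n [T [TP [a an xa]]]].
  exists (fun=> 1); split=> //; exists x; first exact: ilcs0.
  by rewrite big_geq // mul1g; exact: twisted_conj_refl.
pose u : subgroup_of (ilcs G n) := Sub a an.
pose C := [set X | twisted_conj (induced phi n) (induced psi n) X
                     (qclass (@ilcs_next G n) u)].
have clC : classes C by exists (qclass _ u).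
have : C (qclass _ u) by exact: twisted_conj_refl.
rewrite {1}(class_repP clC) /= => /twisted_conj_inducedP[g gn].
rewrite SubK; set t := val (class_rep C); set y := \prod_(0 <= j < n) T j in xa *.
rewrite -(twisted_shift _ _ y _ _ gn) => /esym/qclass_eq.
set b := (phi g)^-1 * (y * t) * psi g => bn.
exists (fun j => if j == n then t else T j); split.
  move=> j; rewrite ltnS leq_eqVlt; case: eqP => [-> _|_ /= /TP //].
  by exists C.
(* The error b^-1 * (y * a) has to be moved inside the twisted conjugation by g. *)
exists ((b^-1 * (y * a)) ^ (psi g)^-1); first exact: ilcsJ.
rewrite big_nat_recr //= eqxx.
have -> : \prod_(0 <= j < n) (if j == n then t else T j) = y.
  by apply: eq_big_nat => j /andP[_ jn]; rewrite ltn_eqF.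
apply: twisted_conj_trans xa _; exists g.
by rewrite -{1}(mulVKg b (y * a)) /conjg invgK {1}/b !mulgA mulgVK.
Qed.

Lemma normal_form_surj x : exists2 C, (forall i, classes (C i)) &
  twisted_conj phi psi x (normal_form C).
Proof.
have [T [TP [a /(ilcs_last tfG nilG) -> xT]]] := twisted_reduce x c.
have CP (i : 'I_c) : exists C, @classes i C /\ T i = val (class_rep C).
  by have [C clC e] := TP i (ltn_ord i); exists C.
exists (fun i => projT1 (cid (CP i))) => [i|].
  by case: (projT2 (cid (CP i))).
rewrite mulg1 in xT; rewrite /normal_form; congr (twisted_conj _ _ _ _): xT.
apply: eq_big_nat => j /andP[_ jc]; rewrite rep_atE.
by have [_] := projT2 (cid (CP (Ordinal jc))).
Qed.

Lemma normal_form_bij :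
  set_bij [set C : forall i : 'I_c, set (ilcs_factor G i) | forall i, classes (C i)]
    (twisted_classes phi psi)
    (fun C => [set x | twisted_conj phi psi x (normal_form C)]).
Proof.
split.
- by move=> C _; exists (normal_form C).
- move=> C D; rewrite !inE => clC clD CD; apply: normal_form_inj => //.
  have : [set x | twisted_conj phi psi x (normal_form C)] (normal_form C).
    exact: twisted_conj_refl.
  by rewrite CD.
- move=> _ [y _ <-]; have [C clC yC] := normal_form_surj y.
  exists C => //; apply/seteqP.
  split=> x /= xy; apply: twisted_conj_trans xy _ => //.
  exact: twisted_conj_sym.
Qed.

End NormalForm.

Theorem proposition2p1 (G : groupType) (c : nat)
    (G_torsion_free : torsion_free G) (G_nilpotent : nilpotent_of_class G c)
    (phi psi : {multiplicative G -> G}) :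
  (finite_rank G -> finite_set (twisted_classes phi psi) ->
   forall i : 'I_c, Coin (induced phi i) (induced psi i) = [set 1])
  /\
  ((forall i : 'I_c, Coin (induced phi i) (induced psi i) = [set 1]) ->
   [/\ exists F : set G -> forall i : 'I_c, set (ilcs_factor G i),
         set_bij (twisted_classes phi psi)
           [set C | forall i : 'I_c,
              twisted_classes (induced phi i) (induced psi i) (C i)] F,
       finite_set (twisted_classes phi psi) <->
         (forall i : 'I_c,
            finite_set (twisted_classes (induced phi i) (induced psi i)))
     & finite_set (twisted_classes phi psi) ->
         reidemeister_number phi psi =
           (\prod_(i < c)
              reidemeister_number (induced phi i) (induced psi i))%N]).
Proof.
have card_factors : (forall i : 'I_c,
      finite_set (twisted_classes (induced phi i) (induced psi i))) ->
    ([set C : forall i : 'I_c, set (ilcs_factor G i) |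
       forall i : 'I_c, twisted_classes (induced phi i) (induced psi i) (C i)] #=
    `I_(\prod_(i < c) reidemeister_number (induced phi i) (induced psi i))%N)%card.
  move=> finC; apply: (@card_eq_dprod _ (fun i : 'I_c => set (ilcs_factor G i))
    (fun i => twisted_classes (induced phi i) (induced psi i))
    (fun i => reidemeister_number (induced phi i) (induced psi i))) => i.
  have /finite_setP[n An] := finC i.
  by rewrite /reidemeister_number (card_fset_set An).
split=> [rG finG i|C1]; first exact: Coin_factors.
have bijE := normal_form_bij G_torsion_free G_nilpotent C1.
have fin_factors : finite_set (twisted_classes phi psi) ->
    forall i : 'I_c, finite_set (twisted_classes (induced phi i) (induced psi i)).
  move=> finG i; apply: factor_classes_finite finG => j ji.
  exact: C1 (Ordinal (ltn_trans ji (ltn_ord i))).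
split.
- exact: set_bij_inv (fun i => set0) bijE.
- split=> // /card_factors cardC; rewrite (eq_finite_set (set_bij_card_eq bijE)).
  by apply/finite_setP; eexists; exact: cardC.
- move=> /fin_factors/card_factors cardC; apply: card_fset_set.
  by rewrite (card_eql (set_bij_card_eq bijE)).
Qed.
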